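(* There exists a tall ideal $\mathcal{I}$ on $\omega$ which is Galvin but not semiselective.
   Context: An ideal on $\omega$ is a family $\mathcal{I}\subseteq\wp(\omega)$ containing all finite sets, with $\omega\notin\mathcal{I}$, closed under subsets and finite unions. $\mathcal{I}^+$ is the family of infinite subsets of $\omega$ not in $\mathcal{I}$. $[X]^{\omega}$ and $[X]^{<\omega}$ denote the families of infinite and of finite subsets of $X$. $\mathcal{I}$ is tall if every $A\in\mathcal{I}^+$ contains an infinite subset belonging to $\mathcal{I}$. For finite $s\subseteq\omega$ and infinite $C\subseteq\omega$, $s\sqsubset C$ means that $s$ is an initial segment of $C$ in its increasing enumeration. For $\mathcal{F}\subseteq[\omega]^{<\omega}$, $\mathrm{hom}(\mathcal{F})$ is the collection of all $B\in[\omega]^\omega$ such that either (I) for every $C\in[B]^\omega$ there is $s\in\mathcal{F}$ with $s\sqsubset C$, or (II) $[B]^{<\omega}\cap\mathcal{F}=\emptyset$. $\mathcal{I}$ is Galvin if for every $\mathcal{F}\subseteq[\omega]^{<\omega}$ and every $A\in\mathcal{I}^+$ there is $B\in\mathcal{I}^+$, $B\subseteq A$, with $B\in\mathrm{hom}(\mathcal{F})$. A set $\mathcal{D}\subseteq\mathcal{I}^+$ is dense-open on $(\mathcal{I}^+,\subseteq)$ if for every $N\in\mathcal{I}^+$ there is $M\in\mathcal{D}$ with $M\subseteq N$, and whenever $N\in\mathcal{I}^+$, $M\in\mathcal{D}$ and $N\subseteq M$, then $N\in\mathcal{D}$. For $D\subseteq\omega$ and $m\in\omega$, $D/m=\{j\in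 D:m<j\}$. $\mathcal{I}$ is semiselective if for every $A\in\mathcal{I}^+$ and every sequence $\{\mathcal{D}_n\}_{n\in\omega}$ of dense-open sets on $(\mathcal{I}^+,\subseteq)$ there is $D\in\mathcal{I}^+$, $D\subseteq A$, such that $D/m\in\mathcal{D}_m$ for all $m\in D$. *)

(* Defs.v *)
From mathcomp Require Import all_boot all_classical.

Set Implicit Arguments.
Unset Strict Implicit.
Unset Printing Implicit Defensive.

Local Open Scope classical_set_scope.

Record is_ideal (I : set (set nat)) : Prop := IsIdeal {
  ideal_fin : forall A, finite_set A -> I A;
  ideal_proper : ~ I setT;
  ideal_sub : forall A B, A `<=` B -> I B -> I A;
  ideal_setU : forall A B, I A -> I B -> I (A `|` B) }.

Definition positive_sets (I : set (set nat)) : set (set nat) :=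
  [set A | infinite_set A /\ ~ I A].

Definition tall (I : set (set nat)) : Prop :=
  forall A, positive_sets I A -> exists B, [/\ B `<=` A, infinite_set B & I B].

(* Finiteness of s is not required here: it is only used for s in a family of
   finite sets (see galvin). *)
Definition initial_segment (s C : set nat) : Prop :=
  s `<=` C /\ forall i j, s j -> C i -> (i < j)%N -> s i.

Definition hom (F : set (set nat)) : set (set nat) :=
  [set B | infinite_set B /\
    ((forall C, infinite_set C -> C `<=` B ->
        exists s, F s /\ initial_segment s C) \/
     (forall s, finite_set s -> s `<=` B -> ~ F s))].

Definition galvin (I : set (set nat)) : Prop :=
  forall F : set (set nat), F `<=` finite_set ->
  forall A, positive_sets I A -> exists B, [/\ positive_sets I B, B `<=` A & hom F B].

Definition dense_open (I D : set (set nat)) : Prop :=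
  [/\ D `<=` positive_sets I,
      (forall N, positive_sets I N -> exists M, D M /\ M `<=` N) &
      (forall N M, positive_sets I N -> D M -> N `<=` M -> D N)].

Definition tail_above (D : set nat) (m : nat) : set nat := [set j | D j /\ (m < j)%N].

Definition semiselective (I : set (set nat)) : Prop :=
  forall A, positive_sets I A ->
  forall D_ : nat -> set (set nat), (forall n, dense_open I (D_ n)) ->
  exists D, [/\ positive_sets I D, D `<=` A & forall m, D m -> D_ m (tail_above D m)].

(* Main.v *)
Require Import Defs.
From mathcomp Require Import all_boot all_classical.

(** The ideal is read off a tree of infinite subsets of [nat], ordered by
inclusion, in which every node has continuum many children: for each family [F]
of finite sets, a node [S] has a child [T `<=` S] lying in [hom F], and distinct
children of [S] are almost disjoint. Such a tree exists in ZFC: an infinite set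
carries an almost disjoint family of size continuum
([almost_disjoint_family]), and by the theorem of Nash-Williams and Galvin
([nash_williams]) every member of it can be shrunk to a homogeneous set.
A set is declared positive when it contains a node.

The homogeneous children give the Galvin property at once. They also make the
complement of the positive sets an ideal: the child of [S] that is homogeneous
for the singletons of [X] is contained in [X] or disjoint from it
([child_inside_or_outside]).

One member of the almost disjoint family on [S], its [rest], is set aside and
given to no child. It is almost disjoint from every node of larger depth than
[S] ([rest_small]), because such a node lies below a child of [S] or is almost
disjoint from [S]. Hence [rest S] contains no node, for below any node there are
nodes of every larger depth; this is tallness. The same fact refutes
semiselectivity. Let [below_level m] consist of the positive sets contained in a
node of depth [m]; it is dense-open, and a diagonalization of these sets inside
[nat] would be a positive [D] whose tails lie in nodes of arbitrarily large
depth. But [D] contains a node [S], and a tail of [rest S], being infinite,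
lies in no node deeper than [S]. *)
Set Implicit Arguments.
Unset Strict Implicit.
Unset Printing Implicit Defensive.

Local Open Scope classical_set_scope.

(** * Infinite sets of natural numbers *)
Lemma finite_set_bounded (s : set nat) : finite_set s -> exists n, s `<=` `I_n.
Proof.
move=> /finite_seqP[l ->]; exists (\max_(i <- l) i).+1 => i /= il.
by rewrite ltnS; apply: (@leq_bigmax_seq _ l xpredT id).
Qed.

Lemma infinite_range (f : nat -> nat) : injective f -> infinite_set (range f).
Proof.
move=> finj; have card_range : (range f #= [set: nat])%card.
  by apply: inj_card_eq => i j _ _; exact: finj.
by rewrite (eq_finite_set card_range); exact: infinite_nat.
Qed.

Lemma infinite_tail_above (A : set nat) m : infinite_set A -> infinite_set (tail_above A m).
Proof.
move=> Ainf; apply: (@sub_infinite_set _ (A `\` `I_m.+1)).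
  by move=> j [Aj /= /negP]; rewrite -leqNgt.
by apply: infinite_setD => //; exact: finite_II.
Qed.

Definition past (s A : set nat) : set nat :=
  [set b | A b /\ forall i, s i -> (i < b)%N].

Lemma infinite_past (s A : set nat) :
  finite_set s -> infinite_set A -> infinite_set (past s A).
Proof.
move=> /finite_set_bounded[n sn] /(infinite_tail_above (m := n)).
apply: sub_infinite_set => j [Aj nj]; split=> // i /sn /= ilt.
exact: ltn_trans nj.
Qed.

Lemma past_sub (s A : set nat) : past s A `<=` A.
Proof. by move=> b []. Qed.

Lemma finite_setU1 (m : nat) s : finite_set s -> finite_set (m |` s).
Proof. by move=> fs; rewrite finite_setU; split=> //; exact: finite_set1. Qed.

(** * Fusion *)

(** The sequence [S] of sets and the sequence [b] of points are chosen together,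
each [b k] in [S k] and [S k.+1] above [b k], so that the points of [range b]
above [b k] all come from [S k.+1], which was chosen to satisfy [R (b k)]. *)
Lemma diagonalization (M : set nat) (R : nat -> set nat -> Prop) :
  infinite_set M ->
  (forall n A A', infinite_set A' -> A' `<=` A -> R n A -> R n A') ->
  (forall n A, infinite_set A -> A `<=` M ->
     exists A', [/\ infinite_set A', A' `<=` A & R n A']) ->
  exists B, [/\ infinite_set B, B `<=` M &
                forall n, B n -> R n (tail_above B n)].
Proof.
move=> Minf Rsub Rdense.
have step A : exists p : nat * set nat, infinite_set A -> A `<=` M ->
    [/\ A p.1, infinite_set p.2, p.2 `<=` tail_above A p.1 & R p.1 p.2].
  have [Ainf|] := pselect (infinite_set A); last by exists (0, A).
  have [AM|] := pselect (A `<=` M); last by exists (0, A).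
  have [m Am] := infinite_setN0 Ainf.
  have [|A' [? ? ?]] := Rdense m (tail_above A m) (infinite_tail_above Ainf).
    by move=> j [/AM].
  by exists (m, A').
have [g gP] := choice step.
pose S k := iter k (fun A => (g A).2) M; pose b k := (g (S k)).1.
have SP k : infinite_set (S k) /\ S k `<=` M.
  elim: k => [|k [Sinf SM]]; first by split.
  have [? ? sub _] := gP _ Sinf SM; split=> //=.
  by move=> j /sub[/SM].
have Sb k : S k (b k) by have [? ?] := SP k; have [] := gP (S k).
have Ssucc k : S k.+1 `<=` tail_above (S k) (b k).
  by have [? ?] := SP k; have [] := gP (S k).
have Rb k : R (b k) (S k.+1) by have [? ?] := SP k; have [] := gP (S k).
have Sdec j k : (j <= k)%N -> S k `<=` S j.
  elim: k => [|k IH]; first by rewrite leqn0 => /eqP ->.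
  rewrite leq_eqVlt => /predU1P[-> //|]; rewrite ltnS => /IH kj i /Ssucc[/kj//].
have bmono j k : (j < k)%N -> (b j < b k)%N.
  by move=> jk; have /(Sdec _ _ jk)/Ssucc[] := Sb k.
have binj : injective b.
  move=> j k bjk; have [/bmono|/bmono|//] := ltngtP j k; by rewrite bjk ltnn.
have binf : infinite_set (range b) by exact: infinite_range.
exists (range b); split=> //.
  by move=> _ [k _ <-]; apply: (SP k).2.
move=> _ [k _ <-]; apply: Rsub (Rb k); first exact: infinite_tail_above.
move=> _ [[j _ <-] bkj]; apply: (Sdec k.+1 j) => //.
rewrite ltnNge leq_eqVlt; apply/negP => /predU1P[jk|/bmono bjk].
  by move: bkj; rewrite jk ltnn.
by move: (ltn_trans bkj bjk); rewrite ltnn.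
Qed.

(** Induction on [n]: a subset of [0..n] is a subset [s] of [0..n-1] or
[n |` s], so the induction hypothesis is used for [P] and then for the property
[P (n |` s)] of [s]. *)
Lemma dense_all_subsets (M : set nat) (P : set nat -> set nat -> Prop) n A :
  (forall s A A', infinite_set A' -> A' `<=` A -> P s A -> P s A') ->
  (forall s A, finite_set s -> infinite_set A -> A `<=` M ->
     exists A', [/\ infinite_set A', A' `<=` A & P s A']) ->
  infinite_set A -> A `<=` M ->
  exists A', [/\ infinite_set A', A' `<=` A & forall s, s `<=` `I_n -> P s A'].
Proof.
elim: n P A => [|n IH] P A Psub Pdense Ainf AM.
  have [A' [? ? PA']] := Pdense set0 A (finite_set0 _) Ainf AM.
  exists A'; split=> // s s0; suff -> : s = set0 by [].
  by apply/seteqP; split=> // i /s0.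
have [A1 [A1inf A1A PA1]] := IH P A Psub Pdense Ainf AM.
have [A2 [A2inf A2A1 PA2]] : exists A2, [/\ infinite_set A2, A2 `<=` A1 &
    forall s, s `<=` `I_n -> P (n |` s) A2].
  apply: (IH (fun s => P (n |` s))) => //.
  - by move=> s; exact: Psub.
  - by move=> s B fs; apply: Pdense; exact: finite_setU1.
  - exact: subset_trans AM.
exists A2; split=> //; first exact: subset_trans A1A.
move=> s sn; have [ns|ns] := pselect (s n).
  rewrite -(setD1K ns); apply: PA2 => i [/sn /=].
  by rewrite ltnS leq_eqVlt => /predU1P[-> //|].
apply: Psub (PA1 s _) => // i si; have /= := sn _ si.
by rewrite ltnS leq_eqVlt => /predU1P[ein|//]; rewrite ein in si.
Qed.

(** In a diagonal intersection the tail above [n] satisfies [P s] for all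
[s] contained in [0..n] simultaneously; a nonempty finite [s] is handled at its
maximum, and the empty set before the diagonalization starts. *)
Lemma fusion (M : set nat) (P : set nat -> set nat -> Prop) :
  infinite_set M ->
  (forall s A A', infinite_set A' -> A' `<=` A -> P s A -> P s A') ->
  (forall s A, finite_set s -> infinite_set A -> A `<=` M ->
     exists A', [/\ infinite_set A', A' `<=` A & P s A']) ->
  exists B, [/\ infinite_set B, B `<=` M &
                forall s, finite_set s -> s `<=` B -> P s (past s B)].
Proof.
move=> Minf Psub Pdense.
have [M0 [M0inf M0M PM0]] := Pdense set0 M (finite_set0 _) Minf (@subset_refl _ _).
have [||B [Binf BM0 PB]] :=
    @diagonalization M0 (fun n A => forall s, s `<=` `I_n.+1 -> P s A) M0inf.
- by move=> n A A' A'inf A'A PA s /PA; exact: Psub.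
- move=> n A Ainf AM0; apply: (dense_all_subsets (M := M)) => //.
  exact: subset_trans M0M.
exists B; split=> //; first exact: subset_trans M0M.
move=> s fs sB; have pinf := infinite_past fs Binf.
have [s0|/set0P[i0 si0]] := eqVneq s set0.
  by rewrite s0 in pinf *; apply: Psub PM0 => //; apply: subset_trans BM0; exact: past_sub.
have [n sn] := finite_set_bounded fs.
have ex : exists i, `[< s i >] by exists i0; apply/asboolP.
have ub i : `[< s i >] -> (i <= n)%N by move=> /asboolP/sn/ltnW.
have [m /asboolP sm mmax] := ex_maxnP ex ub.
apply: Psub (PB m (sB _ sm) s _) => //.
  by move=> j [Bj ltj]; split=> //; exact: ltj.
by move=> i si /=; rewrite ltnS; apply/mmax/asboolP.
Qed.

(** * The theorem of Nash-Williams and Galvin *)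
Section Galvin.
Variable F : set (set nat).

Definition accepts (A s : set nat) : Prop :=
  forall C, infinite_set C -> C `<=` past s A ->
    exists t, F t /\ initial_segment t (s `|` C).

Definition rejects (A s : set nat) : Prop :=
  forall A', infinite_set A' -> A' `<=` A -> ~ accepts A' s.

Lemma accepts_sub (A A' s : set nat) :
  past s A' `<=` A -> accepts A s -> accepts A' s.
Proof.
move=> sub acc C Cinf CA'; apply: acc => // j /CA' pj.
by split; [exact: sub | case: pj].
Qed.

Lemma rejects_sub (A A' s : set nat) : A' `<=` A -> rejects A s -> rejects A' s.
Proof. by move=> sub rej B Binf BA'; apply: rej => //; exact: subset_trans sub. Qed.

Lemma rejects_past (A s : set nat) :
  finite_set s -> rejects (past s A) s -> rejects A s.
Proof.
move=> fs rej A' A'inf A'A acc; apply: (rej (past s A')).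
- exact: infinite_past.
- by move=> j [/A'A ? ?]; split.
- by apply: accepts_sub acc => j [[]].
Qed.

Lemma decide (A s : set nat) : infinite_set A ->
  exists A', [/\ infinite_set A', A' `<=` A & accepts A' s \/ rejects A' s].
Proof.
move=> Ainf.
have [[A' [? ? ?]]|nacc] :=
  pselect (exists A', [/\ infinite_set A', A' `<=` A & accepts A' s]).
  by exists A'; split=> //; left.
by exists A; split=> //; right=> A' ? ? ?; apply: nacc; exists A'.
Qed.

(** An infinite [C] past [s] is [m] followed by a set past [m |` s], where [m]
is its minimum. *)
Lemma accepts_of_min (A s : set nat) :
  (forall m, A m -> accepts A (m |` s)) -> accepts A s.
Proof.
move=> acc C Cinf CA.
have [c Cc] := infinite_setN0 Cinf.
have ex : exists i, `[< C i >] by exists c; apply/asboolP.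
have [m /asboolP Cm mmin] := ex_minnP ex.
have [Am sm] := CA m Cm.
have [||t [Ft tC]] := acc m Am (C `\ m).
- by apply: infinite_setD => //; exact: finite_set1.
- move=> j [Cj /eqP jm]; have [Aj sj] := CA j Cj; split=> // i [->|]; last exact: sj.
  by rewrite ltn_neqAle eq_sym jm; apply/mmin/asboolP.
exists t; split=> //; suff <- : (m |` s) `|` (C `\ m) = s `|` C by [].
by rewrite (setUC [set m]) -setUA setD1K.
Qed.

(** A first fusion gives [B1] that decides all its finite subsets. If [B1]
accepts the empty set, every infinite subset of [B1] has an initial segment in [F].
If it rejects the empty set, then for a rejected [s] only finitely many [m] can
have [m |` s] accepted, since by [accepts_of_min] infinitely many would form a
set accepting [s]. A second fusion discards those [m] and leaves [B2], all of
whose finite subsets are rejected; none is in [F], because a member of [F] is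
accepted by every set. *)
Theorem nash_williams (M : set nat) : infinite_set M ->
  exists B, B `<=` M /\ hom F B.
Proof.
move=> Minf.
have [||B1 [B1inf B1M B1dec]] :=
    @fusion M (fun s A => accepts A s \/ rejects A s) Minf.
- move=> s A A' _ A'A [acc|rej]; [left|right].
    by apply: accepts_sub acc => j /past_sub/A'A.
  exact: rejects_sub rej.
- by move=> s A _ Ainf _; exact: decide.
have dec s : finite_set s -> s `<=` B1 -> accepts B1 s \/ rejects B1 s.
  move=> fs /(B1dec s fs)[acc|rej]; [left|right].
    exact: accepts_sub acc.
  exact: rejects_past.
have [acc0|rej0] := dec set0 (finite_set0 _) (sub0set _).
  exists B1; split=> //; split=> //; left=> C Cinf CB1.
  have [|t tP] := acc0 C Cinf; first by move=> j /CB1.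
  by exists t; rewrite set0U in tP.
have [||B2 [B2inf B2B1 B2rej]] := @fusion B1 (fun s A => s `<=` B1 ->
    rejects B1 s -> forall m, past s A m -> rejects B1 (m |` s)) B1inf.
- move=> s A A' _ A'A PA sB1 rej m [A'm sm]; apply: PA => //.
  by split=> //; exact: A'A.
- move=> s A fs Ainf AB1.
  pose X := [set m | A m /\ accepts B1 (m |` s)].
  have [Xfin|Xinf] := pselect (finite_set X).
    exists (A `\` X); split; [exact: infinite_setD|exact: subDsetl|].
    move=> sB1 rej m [[Am nXm] sm].
    have [|acc|//] := dec (m |` s) (finite_setU1 _ fs).
      by move=> i [->|/sB1//]; exact: AB1.
    by exfalso; apply: nXm.
  exists A; split=> // _ rej; exfalso; apply: (rej X Xinf) => [j [/AB1]//|].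
  apply: accepts_of_min => m [Am acc]; apply: accepts_sub acc => j [[/AB1]//].
have rej n s : s `<=` `I_n -> s `<=` B2 -> rejects B1 s.
  elim: n s => [|n IH] s sn sB2.
    by suff -> : s = set0 by []; apply/seteqP; split=> // i /sn.
  have [ns|ns] := pselect (s n); last first.
    apply: IH => // i si; have /= := sn _ si.
    by rewrite ltnS leq_eqVlt => /predU1P[ein|//]; rewrite ein in si.
  have s'n : s `\ n `<=` `I_n.
    move=> i [/sn /=]; rewrite ltnS leq_eqVlt => /predU1P[-> //|//].
  have s'B2 : s `\ n `<=` B2 by move=> i [/sB2].
  have fs' : finite_set (s `\ n) by apply: sub_finite_set s'n _; exact: finite_II.
  rewrite -(setD1K ns); apply: (B2rej _ fs' s'B2).
  - exact: subset_trans B2B1.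
  - exact: IH.
  - by split; [split; [exact: sB2|exact: s'n]|exact: s'n].
exists B2; split; first exact: subset_trans B1M.
split=> //; right=> s fs sB2 Fs.
have [n sn] := finite_set_bounded fs.
apply: (rej n s sn sB2 B1) => // C Cinf CB1; exists s; split=> //; split.
  by move=> i si; left.
by move=> i j sj [//|/CB1[_ /(_ j sj)]] ji ij; move: (ltn_trans ji ij); rewrite ltnn.
Qed.
End Galvin.

(** * The splitting of a node *)

(** Embed the countable tree of finite sequences over [T] into [A]; to
[x : nat -> T] corresponds the branch of its finite initial segments. Two
different branches separate at some length and share no longer segment. *)
Lemma almost_disjoint_family (T : countType) (A : set nat) : infinite_set A ->
  exists f : (nat -> T) -> set nat, (forall x, infinite_set (f x) /\ f x `<=` A) /\
    (forall x y, x <> y -> finite_set (f x `&` f y)).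
Proof.
move=> /infiniteP/pcard_leP[e].
have einj : injective e by move=> i j eij; apply: (@inj _ _ _ e) => //; rewrite inE.
pose b (x : nat -> T) n := e (pickle (mkseq x n)).
have binj x y m n : b x m = b y n -> m = n /\ mkseq x m = mkseq y n.
  move=> /einj/(pcan_inj pickleK) exy; split=> //.
  by rewrite -(size_mkseq x m) exy size_mkseq.
exists (fun x => range (b x)); split.
  move=> x; split; last by move=> _ [n _ <-]; apply: funS.
  have bxinj : injective (b x) by move=> m n /binj[].
  exact: infinite_range.
move=> x y nxy.
have [k nxyk] : exists k, x k <> y k.
  by apply: contrapT => /forallNP nk; apply/nxy/funext => k; apply: contrapT => /nk.
apply: (@sub_finite_set _ _ (b x @` `I_k.+1)); last exact/finite_image/finite_II.
move=> _ [[m _ <-] [n _ /esym/binj[<- exy]]]; exists m => //=.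
rewrite ltnNge; apply/negP => km; apply: nxyk.
by rewrite -(nth_mkseq (x 0) x km) exy nth_mkseq.
Qed.

(** Families of finite sets of natural numbers are indexed by [nat -> bool]
through an enumeration of the finite sequences, so that the almost disjoint
family above can be indexed by the families. *)
Definition decode (x : nat -> bool) : set (set nat) :=
  [set s | exists l : seq nat, x (pickle l) /\ s = [set` l]].

Lemma decode_surj (F : set (set nat)) : F `<=` finite_set -> exists x, F = decode x.
Proof.
move=> Ffin.
exists (fun n => if unpickle n is Some l then `[< F [set` (l : seq nat)] >] else false).
apply/seteqP; split=> [s Fs|s [l []]].
  have /finite_seqP[l sl] := Ffin s Fs; exists l; split=> //.
  by rewrite pickleK; apply/asboolP; rewrite -sl.
by rewrite pickleK => /asboolP Fl ->.
Qed.

(** The set [r] witnesses that the children do not exhaust [A]: both tallness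
and the failure of semiselectivity rest on it. *)
Record splitting (A : set nat) (c : (nat -> bool) -> set nat) (r : set nat) : Prop :=
  Splitting {
    child_sub : forall x, c x `<=` A;
    child_hom : forall x, hom (decode x) (c x);
    child_ad : forall x y, x <> y -> finite_set (c x `&` c y);
    rest_inf : infinite_set r;
    rest_sub : r `<=` A;
    rest_ad : forall x, finite_set (r `&` c x) }.

(** Over [option bool] the constant sequence [None] differs from all sequences
of booleans, so its branch is available as the rest. *)
Lemma splitting_exists (A : set nat) : infinite_set A -> exists c r, splitting A c r.
Proof.
move=> Ainf.
have [f [fP fad]] := almost_disjoint_family (option bool) Ainf.
have fsomeP x : exists B, B `<=` f (Some \o x) /\ hom (decode x) B.
  by apply: nash_williams; exact: (fP _).1.
have [c cP] := choice fsomeP.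
exists c, (f (fun=> None)); split.
- by move=> x; apply: subset_trans (fP _).2; exact: (cP x).1.
- by move=> x; exact: (cP x).2.
- move=> x y nxy; apply: sub_finite_set (fad (Some \o x) (Some \o y) _).
    by apply: setISS; [exact: (cP x).1|exact: (cP y).1].
  by move=> exy; apply: nxy; apply/funext => n; have [] := congr1 (@^~ n) exy.
- exact: (fP _).1.
- exact: (fP _).2.
- move=> x; apply: sub_finite_set (fad (fun=> None) (Some \o x) _).
    by apply: setIS; exact: (cP x).1.
  by move=> /(congr1 (@^~ 0)).
Qed.

(** * The tree and its ideal *)
Section Tree.
Variables (child : set nat -> (nat -> bool) -> set nat) (rest : set nat -> set nat).
Hypothesis splitP : forall A, infinite_set A -> splitting A (child A) (rest A).

Fixpoint level n : set (set nat) :=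
  if n is m.+1 then [set T | exists S x, level m S /\ T = child S x] else [set setT].

Lemma level_infinite n T : level n T -> infinite_set T.
Proof.
elim: n T => [|n IH] T /=; first by move=> ->; exact: infinite_nat.
by move=> [S [x [/IH/splitP Ssplit ->]]]; exact: (child_hom Ssplit x).1.
Qed.

Lemma level_splitting n T : level n T -> splitting T (child T) (rest T).
Proof. by move=> /level_infinite/splitP. Qed.

Lemma level_ancestor m n T : (m <= n)%N -> level n T ->
  exists2 S, level m S & T `<=` S.
Proof.
elim: n T => [|n IH] T; first by rewrite leqn0 => /eqP ->; exists T.
rewrite leq_eqVlt => /predU1P[->|mn] LT; first by exists T.
have [S [x [LS ->]]] := LT; have [U LU SU] := IH S mn LS; exists U => //.
by apply: subset_trans SU; exact: (child_sub (level_splitting LS)).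
Qed.

Lemma level_descendant m n S : (m <= n)%N -> level m S ->
  exists2 T, level n T & T `<=` S.
Proof.
elim: n => [|n IH]; first by rewrite leqn0 => /eqP ->; exists S.
rewrite leq_eqVlt => /predU1P[-> LS|mn /(IH mn)[T LT TS]]; first by exists S.
exists (child T xpred0); first by exists T, xpred0.
by apply: subset_trans TS; exact: (child_sub (level_splitting LT)).
Qed.

Lemma level_ad n S T : level n S -> level n T -> S <> T -> finite_set (S `&` T).
Proof.
elim: n S T => [|n IH] S T /=; first by move=> -> ->.
move=> [S' [x [LS' ->]]] [T' [y [LT' ->]]] neq.
have [ST'|ST'] := pselect (S' = T').
  rewrite -ST' in neq *; apply: (child_ad (level_splitting LS')) => xy.
  by rewrite xy in neq.
apply: sub_finite_set (IH _ _ LS' LT' ST').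
by apply: setISS; [exact: (child_sub (level_splitting LS'))|
  exact: (child_sub (level_splitting LT'))].
Qed.

(** The node [T] lies below a child of some node [S'] of the depth of [S]. If
[S' = S], that child is almost disjoint from [rest S]; otherwise [S'] is almost
disjoint from [S]. *)
Lemma rest_small m n S T : level m S -> level n T -> (m < n)%N ->
  finite_set (rest S `&` T).
Proof.
move=> LS LT mn; have [_ [S' [x [LS' ->]]] TU] := level_ancestor mn LT.
have [eS|SS'] := pselect (S = S').
  rewrite -eS in TU; apply: sub_finite_set (rest_ad (level_splitting LS) x).
  exact: setIS.
apply: sub_finite_set (level_ad LS LS' SS').
apply: setISS; first exact: (rest_sub (level_splitting LS)).
by apply: subset_trans TU _; exact: (child_sub (level_splitting LS')).
Qed.

Definition tree_ideal : set (set nat) :=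
  [set X | ~ exists n T, level n T /\ T `<=` X].

Lemma positiveP X : positive_sets tree_ideal X <-> exists n T, level n T /\ T `<=` X.
Proof.
split=> [[_ /contrapT//]|posX]; split=> [|/(_ posX)//].
have [n [T [/level_infinite Tinf TX]]] := posX.
exact: sub_infinite_set TX Tinf.
Qed.

Lemma level_positive n T : level n T -> positive_sets tree_ideal T.
Proof. by move=> LT; apply/positiveP; exists n, T; split. Qed.

Lemma singletons_finite (X : set nat) : [set [set x] | x in X] `<=` finite_set.
Proof. by move=> _ [x _ <-]; exact: finite_set1. Qed.

Lemma hom_child F n S : F `<=` finite_set -> level n S ->
  exists T, [/\ level n.+1 T, T `<=` S & hom F T].
Proof.
move=> /decode_surj[x ->] LS; exists (child S x); split.
- by exists S, x.
- exact: (child_sub (level_splitting LS)).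
- exact: (child_hom (level_splitting LS)).
Qed.

(** This is homogeneity for the family of singletons of [X]. In the first
alternative, the infinite sets to test are the final segments of the child,
which force each of its points to be in [X]. *)
Lemma child_inside_or_outside X n S : level n S ->
  exists T, [/\ level n.+1 T, T `<=` S & T `<=` X \/ T `<=` ~` X].
Proof.
move=> LS; have [T [LT TS [_ Thom]]] := hom_child (@singletons_finite X) LS.
exists T; split=> //; case: Thom => [inX|offX]; [left|right] => b Tb; last first.
  move=> Xb; apply: (offX [set b]); [exact: finite_set1|by move=> _ ->|by exists b].
have [||_ [[x Xx <-] [sub init]]] := inX (b |` tail_above T b).
- apply: sub_infinite_set (infinite_tail_above (level_infinite LT) (m := b)).
  by move=> j ?; right.
- by move=> j [->//|[]].
have [<-//|[_ bx]] : (b |` tail_above T b) x by apply: sub.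
by have -> : b = x by apply: (init b x erefl _ bx); left.
Qed.

Lemma tree_ideal_ideal : is_ideal tree_ideal.
Proof.
split.
- by move=> A Afin [n [T [/level_infinite Tinf TA]]]; apply/Tinf/(sub_finite_set TA).
- by apply; exists 0, setT.
- by move=> A B AB IB [n [T [LT TA]]]; apply: IB; exists n, T; split=> //; exact: subset_trans AB.
- move=> A B IA IB [n [S [LS SAB]]].
  have [T [LT TS [TA|TA]]] := child_inside_or_outside A LS.
    by apply: IA; exists n.+1, T.
  apply: IB; exists n.+1, T; split=> // j Tj.
  by have [/(TA _ Tj)|] := SAB _ (TS _ Tj).
Qed.

(** If [rest S] contained a node, it would contain one deeper than [S], almost
disjoint from it. *)
Lemma tree_ideal_tall : tall tree_ideal.
Proof.
move=> A /positiveP[n [S [LS SA]]]; have Ssplit := level_splitting LS.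
exists (rest S); split.
- exact: subset_trans (rest_sub Ssplit) SA.
- exact: (rest_inf Ssplit).
- move=> [m [T [LT Tr]]].
  have [U LU UT] := level_descendant (leq_maxl m n.+1) LT.
  apply: (level_infinite LU); apply: sub_finite_set (rest_small LS LU (leq_maxr m n.+1)).
  by move=> j Uj; split=> //; exact/Tr/UT.
Qed.

Lemma tree_ideal_galvin : galvin tree_ideal.
Proof.
move=> F Ffin A /positiveP[n [S [LS SA]]].
have [T [LT TS Thom]] := hom_child Ffin LS.
exists T; split=> //; last exact: subset_trans TS SA.
exact: level_positive LT.
Qed.

Definition below_level m : set (set nat) :=
  [set X | positive_sets tree_ideal X /\ exists2 T, level m T & X `<=` T].

Lemma below_level_dense_open m : dense_open tree_ideal (below_level m).
Proof.
split=> [X []//|N|N M posN [_ [T LT MT]] NM]; last first.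
  by split=> //; exists T => //; exact: subset_trans MT.
move=> /positiveP[n [S [LS SN]]].
have [U LU US] := level_descendant (leq_maxl n m) LS.
exists U; split; last exact: subset_trans SN.
split; first exact: level_positive LU.
exact: level_ancestor (leq_maxr n m) LU.
Qed.

(** If [D] diagonalizes the sets [below_level m], take a node [S `<=` D] of
depth [k] and [m] in [D] with [k < m]: the tail of [rest S] above [m] lies in a
node of depth [m], against [rest_small]. *)
Lemma tree_ideal_not_semiselective : ~ semiselective tree_ideal.
Proof.
move=> semi; have posT : positive_sets tree_ideal setT by exact: (@level_positive 0).
have [D [posD _ DP]] := semi setT posT below_level below_level_dense_open.
have /positiveP[k [S [LS SD]]] := posD.
have [m [Dm km]] := infinite_setN0 (infinite_tail_above posD.1 (m := k)).
have [_ [T LT DT]] := DP m Dm.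
have rinf := rest_inf (level_splitting LS).
apply: (infinite_tail_above rinf (m := m)).
apply: sub_finite_set (rest_small LS LT km) => j [rj mj]; split=> //.
by apply: DT; split=> //; apply/SD/(rest_sub (level_splitting LS)).
Qed.

End Tree.

Theorem theorem4p19 :
  exists I : set (set nat), [/\ is_ideal I, tall I, galvin I & ~ semiselective I].
Proof.
have split_all A : exists p : ((nat -> bool) -> set nat) * set nat,
    infinite_set A -> splitting A p.1 p.2.
  have [/splitting_exists[c [r cr]]|] := pselect (infinite_set A); first by exists (c, r).
  by exists (fun=> set0, set0).
have [g gP] := choice split_all.
exists (tree_ideal (fun A => (g A).1)); split.
- exact: (tree_ideal_ideal (rest := fun A => (g A).2)).
- exact: (tree_ideal_tall (rest := fun A => (g A).2)).
- exact: (tree_ideal_galvin (rest := fun A => (g A).2)).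
- exact: (tree_ideal_not_semiselective (rest := fun A => (g A).2)).
Qed.
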